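(* For a graph $G$ with maximum degree $\Delta$, $$\dim_{\mathrm{TH}}(G) \leq (24300 + o(1))\, \Delta \ln^{2}\Delta\, \ln\ln\Delta\,(2e)^{\sqrt{(1+o(1))\ln\ln\Delta}},$$ where the $o(1)$ terms denote quantities tending to $0$ as $\Delta\to\infty$.
   Context: A graph $G$ on $n$ vertices is a threshold graph if there exist real numbers $a_1,\dots,a_n,b$ such that the $0$-$1$ solutions of $\sum_{i=1}^n a_ix_i\le b$ are exactly the characteristic vectors of the cliques of $G$ (equivalently, $G$ has no induced $2K_2$, $P_4$ or $C_4$). For graphs $G_1,\dots,G_k$ on the same vertex set $V$, $G=G_1\cap\cdots\cap G_k$ means $V(G)=V$ and $E(G)=\bigcap_i E(G_i)$. The threshold dimension $\dim_{\mathrm{TH}}(G)$ is the smallest $k$ such that $G$ is the intersection of $k$ threshold graphs on $V(G)$. Graphs are finite, simple and undirected. *)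

(* Defs.v *)
From HB Require Import structures.
From mathcomp Require Import all_boot all_order all_algebra.
From mathcomp Require Import all_classical all_reals all_analysis.

Set Implicit Arguments.
Unset Strict Implicit.
Unset Printing Implicit Defensive.

Import Order.TTheory GRing.Theory Num.Theory.
Import numFieldNormedType.Exports.

Local Open Scope ring_scope.

Record sgraph (V : finType) := SGraph {
  edge :> rel V;
  edge_sym : symmetric edge;
  edge_irr : irreflexive edge }.

Definition degree (V : finType) (G : sgraph V) (v : V) : nat :=
  #|[set w | G v w]|.

Definition max_degree (V : finType) (G : sgraph V) : nat :=
  \max_(v : V) degree G v.

Definition clique (V : finType) (G : sgraph V) (A : {set V}) : bool :=
  [forall u in A, forall v in A, (u != v) ==> G u v].

(* [x] is a 0-1 vector indexed by [V]; it is the characteristic vector of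
   [[set i | x i]]. *)
Definition threshold_graph (R : realType) (V : finType) (G : sgraph V) : Prop :=
  exists (a : V -> R) (b : R), forall x : {ffun V -> bool},
    (\sum_(i : V) a i * (x i)%:R <= b) = clique G [set i | x i].

(* [0 < k] excludes the empty intersection, so a complete graph has threshold
   dimension 1. *)
Definition threshold_intersection (R : realType) (V : finType) (G : sgraph V)
    (k : nat) : Prop :=
  (0 < k)%N /\
  exists H : 'I_k -> sgraph V,
    (forall i, threshold_graph R (H i)) /\
    (forall u v, G u v = [forall i, H i u v]).

Section CoPair.
Variables (V : finType) (S : {set V}).

Definition copair_edge : rel V := fun x y => (x != y) && ([set x; y] != S).

Lemma copair_sym : symmetric copair_edge.
Proof. by move=> x y; rewrite /copair_edge eq_sym finset.setUC. Qed.

Lemma copair_irr : irreflexive copair_edge.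
Proof. by move=> x; rewrite /copair_edge eqxx. Qed.

(* The complete graph minus the edge [S] if [#|S| = 2], else the complete
   graph. *)
Definition copair : sgraph V := SGraph copair_sym copair_irr.

Lemma copair_threshold (R : realType) : threshold_graph R copair.
Proof.
case: (boolP (#|S| == 2)%N) => [/cards2P[u [v [uv SE]]]|S2]; last first.
  exists (fun=> 0), 0 => x; rewrite big1 => [|i _]; last by rewrite mul0r.
  rewrite lexx.
  apply/esym/forall_inP => i _; apply/forall_inP => j _; apply/implyP => ij.
  rewrite /= /copair_edge ij /=; apply: contraNneq S2 => <-.
  by rewrite cards2 ij.
exists (fun i => (i \in S)%:R), 1 => x.
have -> : \sum_i (i \in S)%:R * (x i)%:R = ((x u + x v)%N)%:R :> R.
  rewrite (bigD1 u) //= (bigD1 v) ?(eq_sym v) //= big1 => [|i /andP[iu iv]].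
    by rewrite SE !inE !eqxx orbT !mul1r addr0 natrD.
  by rewrite SE !inE (negbTE iu) (negbTE iv) mul0r.
rewrite -[1]/(1%:R) ler_nat.
have -> : (x u + x v <= 1)%N = ~~ (x u && x v) by case: (x u); case: (x v).
apply/idP/forall_inP => [xuv i|cl].
  rewrite inE => xi; apply/forall_inP => j; rewrite inE => xj.
  apply/implyP => ij; rewrite /= /copair_edge ij /=.
  apply: contraNneq xuv => E.
  have all_x w : w \in S -> x w by rewrite -E !inE => /orP[] /eqP->.
  by rewrite !all_x // SE !inE eqxx ?orbT.
apply/negP => /andP[xu xv].
have /cl/forall_inP/(_ v) : u \in [set i | x i] by rewrite inE.
by rewrite inE xv uv /= /copair_edge SE eqxx andbF => /(_ isT).
Qed.

End CoPair.

Lemma threshold_intersection_ex (R : realType) (V : finType) (G : sgraph V) :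
  exists k : nat, `[< threshold_intersection R G k >].
Proof.
pose is_edge (S : {set V}) := [exists x, exists y, G x y && (S == [set x; y])].
exists #|{: {set V}}|; apply/asboolP; split.
  by apply/card_gt0P; exists finset.set0.
exists (fun i => let S := enum_val i in
  copair (if is_edge S then finset.set0 else S)); split.
  by move=> i; exact: copair_threshold.
move=> u v; apply/idP/forallP => [Guv i /=|H].
  have uv : u != v by apply: contraTneq Guv => ->; rewrite edge_irr.
  rewrite /copair_edge uv /=; case: ifPn => [_|].
    by apply/eqP => /setP/(_ u); rewrite !inE eqxx.
  apply: contraNneq => <-.
  by apply/existsP; exists u; apply/existsP; exists v; rewrite Guv eqxx.
have := H (enum_rank [set u; v]); rewrite /= enum_rankK /copair_edge.
case: ifPn => [/existsP[x /existsP[y /andP[Gxy /eqP E]]]|_]; last first.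
  by rewrite eqxx andbF.
case/andP => uv _.
have : u \in [set x; y] by rewrite -E !inE eqxx.
have : v \in [set x; y] by rewrite -E !inE eqxx orbT.
rewrite !inE => /orP[]/eqP vE /orP[]/eqP uE; move: uv; rewrite uE vE ?eqxx //.
by rewrite edge_sym.
Qed.

Definition dimTH (R : realType) (V : finType) (G : sgraph V) : nat :=
  ex_minn (threshold_intersection_ex R G).

(* Main.v *)
Require Import Defs.
From HB Require Import structures.
From mathcomp Require Import all_boot all_order all_algebra.
From mathcomp Require Import all_classical all_reals all_analysis.
From mathcomp Require Import unstable zify ring lra.

(* Let [d = Delta + 1].  Fix [M = O(ln Delta)] hash functions from a set of
   [8 d^4] colours to [16 d] classes, and colour the vertices.  Call a closed
   neighbourhood crowded if, for some colour [x], at least half of the hash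
   functions send [x] to the class of another colour of the neighbourhood.  For
   random hash functions and a random colouring a given neighbourhood is
   crowded, or not rainbow, with probability [O(d^-2)].  Averaging fixes the
   hash functions independently of the graph; once they are fixed, badness of a
   neighbourhood depends only on the colours inside it, and the local lemma
   yields a colouring without bad neighbourhoods.

   For a nonedge [uw], some hash function [i] then separates the colour of [u]
   from all other colours in both closed neighbourhoods.  The set [A] of the
   vertices that lie in the class of [u] under [i] and have no neighbour there
   is independent, contains [u], and contains at most one neighbour of [w], as
   such a neighbour has the colour of [u].  In the split graph that has [A] as
   independent set, its complement as clique, and [w] adjacent to the elements
   of [A] up to its last neighbour in some order, [uw] is missing for that order
   of [V] or its reverse.  Such split graphs are threshold, so
   [dim_TH(G) <= 2 * 16 d * M = O(Delta ln Delta)], and the constants are small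
   enough for both error terms to be identically zero. *)

Set Implicit Arguments.
Unset Strict Implicit.
Unset Printing Implicit Defensive.

Import Order.TTheory GRing.Theory Num.Theory.
Import numFieldNormedType.Exports.

Local Open Scope ring_scope.

(** * The symmetric local lemma by counting *)

Section LocalLemma.
Local Open Scope nat_scope.
Variables (V K : finType).
Implicit Types (N : {set V}) (E F : {set {ffun V -> K}}).

Definition depends_on N E : Prop :=
  forall f g : {ffun V -> K}, {in N, f =1 g} -> (f \in E) = (g \in E).

(** Exchanging the coordinates outside [N] of a pair [(f, g)] is an involution. For [f] in both
    events and [g] arbitrary it yields a pair in [E] times [F]. *)
Lemma card_indep_le N E F : depends_on N E -> depends_on (~: N) F ->
  #|E :&: F| * #|{ffun V -> K}| <= #|E| * #|F|.
Proof.
move=> depE depF; rewrite -cardsT -!cardsX.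
pose mix (f g : {ffun V -> K}) := [ffun v => if v \in N then f v else g v].
pose swap (p : {ffun V -> K} * {ffun V -> K}) := (mix p.1 p.2, mix p.2 p.1).
have swapK : involutive swap.
  case=> f g; rewrite /swap /=.
  by congr pair; apply/ffunP => v; rewrite !ffunE; case: (v \in N).
rewrite -(card_imset _ (inv_inj swapK)).
apply/subset_leq_card/fintype.subsetP => _ /imsetP[[f g] + ->].
rewrite !inE andbT => /andP[fE fF]; apply/andP; split => /=.
  by rewrite (depE _ f) // => v vN; rewrite ffunE vN.
by rewrite (depF _ f) // => v; rewrite inE ffunE => /negbTE ->.
Qed.

(** Overwriting [f x] loses nothing, since it can be read off from [f y]. *)
Lemma card_eq_coord (x y : V) : x != y ->
  #|[set f : {ffun V -> K} | f x == f y]| * #|K| <= #|{ffun V -> K}|.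
Proof.
move=> xy; rewrite -(cardsT K) -cardsX.
pose upd (p : {ffun V -> K} * K) := [ffun v => if v == x then p.2 else p.1 v].
rewrite -(card_in_imset (f := upd)); first exact: max_card.
move=> [f a] [g b]; rewrite !inE !andbT /= => /eqP fxy /eqP gxy /ffunP E.
have fg v : v != x -> f v = g v.
  by move=> vx; have := E v; rewrite !ffunE (negbTE vx).
congr (_, _); last by have := E x; rewrite !ffunE eqxx.
apply/ffunP => v; have [->|/fg//] := eqVneq v x.
by rewrite fxy gxy fg // eq_sym.
Qed.

Variables (I : finType) (N : I -> {set V}) (bad : I -> {set {ffun V -> K}}).
Variable D : nat.

Definition avoid (S : {set I}) : {set {ffun V -> K}} :=
  [set f | [forall i in S, f \notin bad i]].

Lemma avoidP (S : {set I}) f :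
  reflect (forall i, i \in S -> f \notin bad i) (f \in avoid S).
Proof. by rewrite inE; apply: (iffP forall_inP). Qed.

Hypothesis K0 : 0 < #|K|.
Hypothesis D0 : 0 < D.
Hypothesis dep : forall i, depends_on (N i) (bad i).
Hypothesis local : forall i, #|[set j | ~~ [disjoint N i & N j]]| <= D.
Hypothesis rare : forall i, 4 * D * #|bad i| <= #|{ffun V -> K}|.

(** Events of [S] far from [i] are independent of [bad i]. By induction the at most [D] near ones
    cover at most half of what avoids the far ones, so avoiding them too costs a factor of at most
    2. *)
Lemma bad_given_avoid (S : {set I}) (i : I) :
  2 * D * #|bad i :&: avoid S| <= #|avoid S|.
Proof.
have [n] := ubnP #|S|; elim: n S i => // n IHn S i; rewrite ltnS => Sn.
pose C := [set j | ~~ [disjoint N i & N j]].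
have far : 4 * D * #|bad i :&: avoid (S :\: C)| <= #|avoid (S :\: C)|.
  have indep : depends_on (~: N i) (avoid (S :\: C)).
    move=> f g fg; rewrite !inE; apply: eq_forallb => j.
    case: (boolP (j \in _)) => //=; rewrite !inE negbK => /andP[dij _].
    congr negb; apply: dep => v vj; apply: fg; rewrite inE.
    by apply: contraTN vj => vi; rewrite (disjointFr dij vi).
  have O0 : 0 < #|{ffun V -> K}| by rewrite card_ffun expn_gt0 K0.
  rewrite -(leq_pmul2r O0) -mulnA.
  apply: leq_trans (leq_mul (leqnn _) (card_indep_le (@dep i) indep)) _.
  by rewrite mulnA mulnC leq_mul2l rare orbT.
have subI (A B : {set I}) E : A \subset B ->
    #|E :&: avoid B| <= #|E :&: avoid A|.
  move=> AB; apply/subset_leq_card/finset.setIS/fintype.subsetP => f.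
  by move=> /avoidP fB; apply/avoidP => j /(fintype.subsetP AB)/fB.
have le1 := subI _ _ (bad i) (subsetDl S C).
suff : #|avoid (S :\: C)| <= 2 * #|avoid S| by nia.
(* Without near events [S :\: C] is no smaller than [S], so this case must be settled without
   induction. *)
have [C0|C0] := eqVneq (S :&: C) finset.set0.
  have -> : S :\: C = S; last by rewrite leq_pmull.
  by apply/finset.setDidPl; rewrite -setI_eq0 C0.
have small : #|S :\: C| < n.
  apply: leq_trans Sn.
  by rewrite -(cardsID C S) -addn1 addnC leq_add2r card_gt0.
have cover : avoid (S :\: C) \subset
    avoid S :|: \bigcup_(j in S :&: C) (bad j :&: avoid (S :\: C)).
  apply/fintype.subsetP => f fSC; rewrite inE.
  have [//|fS /=] := boolP (f \in avoid S).
  have [j jS fj] : exists2 j, j \in S & f \in bad j.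
    move: fS; rewrite inE negb_forall_in => /exists_inP[j jS].
    by rewrite negbK; exists j.
  have jC : j \in C.
    by apply: contraLR fj => jC; apply: (avoidP _ _ fSC); rewrite inE jC jS.
  by apply/bigcupP; exists j; rewrite inE ?jS ?fj.
have sum_le : 2 * D * \sum_(j in S :&: C) #|bad j :&: avoid (S :\: C)|
    <= D * #|avoid (S :\: C)|.
  rewrite big_distrr /=.
  apply: leq_trans (leq_sum _ (fun j _ => IHn (S :\: C) j small)) _.
  rewrite sum_nat_const leq_mul2r (leq_trans _ (local i)) ?orbT //.
  by apply/subset_leq_card/subsetIr.
have le2 := leq_trans (subset_leq_card cover) (leq_card_setU _ _).1.
have le3 : #|avoid (S :\: C)| <=
    #|avoid S| + \sum_(j in S :&: C) #|bad j :&: avoid (S :\: C)|.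
  by apply: leq_trans le2 _; rewrite leq_add2l; exact: card_big_setU.
nia.
Qed.

Theorem local_lemma : exists f, forall i, f \notin bad i.
Proof.
suff pos (S : {set I}) : 0 < #|avoid S|.
  have [f /avoidP fT] := card_gt0P (pos [set: I]).
  by exists f => i; apply: fT; rewrite inE.
have [n] := ubnP #|S|; elim: n S => // n IHn S; rewrite ltnS => Sn.
have [->|/set0Pn[i iS]] := eqVneq S finset.set0.
  have /card_gt0P[f _] : 0 < #|{ffun V -> K}| by rewrite card_ffun expn_gt0 K0.
  by apply/card_gt0P; exists f; apply/avoidP => i; rewrite inE.
have Si : #|S :\ i| < n by move: Sn; rewrite (cardsD1 i) iS.
have := IHn _ Si; have := bad_given_avoid (S :\ i) i.
rewrite -(cardsID (bad i) (avoid (S :\ i))) finset.setIC.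
have -> : avoid (S :\ i) :\: bad i = avoid S.
  apply/setP => f; rewrite finset.in_setD.
  apply/andP/avoidP => [[fi /avoidP fS] j jS|fS].
    by have [->//|ji] := eqVneq j i; apply: fS; rewrite !inE ji.
  by split; [exact: fS|apply/avoidP => j; rewrite !inE => /andP[_ /fS]].
nia.
Qed.
End LocalLemma.

(** * Hashing colours *)

Section Hashing.
Local Open Scope nat_scope.
Variables (K C : finType) (M : nat).
Local Notation hash := {ffun 'I_M -> {ffun K -> C}}.
Implicit Types (X Y : {set K}) (g : {ffun K -> C}) (m : hash).

Definition collides X (x : K) g : bool :=
  [exists y in X, (y != x) && (g y == g x)].

(** The colour [x] need not lie in [X]: the colour of [u] is also tested against the neighbourhood
    of a nonneighbour [w]. *)
Definition crowded_at m X (x : K) : bool :=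
  M <= 2 * #|[set i | collides X x (m i)]|.

Definition crowded m X : bool := [exists x, crowded_at m X x].

Lemma crowded_sub m X Y : X \subset Y -> crowded m X -> crowded m Y.
Proof.
move=> XY /existsP[x crx]; apply/existsP; exists x; apply: leq_trans crx _.
rewrite leq_mul2l; apply/subset_leq_card/fintype.subsetP => i; rewrite !inE.
case/exists_inP => y yX cy; apply/exists_inP; exists y => //.
exact: (fintype.subsetP XY).
Qed.

Lemma card_collides d X x : #|X| <= d -> 16 * d <= #|C| ->
  16 * #|[set g | collides X x g]| <= #|{ffun K -> C}|.
Proof.
move=> Xd dC; set Q := [set g | _].
have QC : #|Q| * #|C| <= #|X| * #|{ffun K -> C}|.
  have QU : Q \subset
      \bigcup_(y in X :\ x) [set g : {ffun K -> C} | g y == g x].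
    apply/fintype.subsetP => g; rewrite inE => /exists_inP [y yX /andP[yx gy]].
    by apply/bigcupP; exists y; rewrite inE // inE yx.
  apply: leq_trans (leq_mul (subset_leq_card QU) (leqnn _)) _.
  apply: leq_trans (leq_mul (card_big_setU _ _ _) (leqnn _)) _.
  rewrite big_distrl /=.
  apply: (@leq_trans (\sum_(y in X :\ x) #|{ffun K -> C}|)).
    by apply: leq_sum => y; rewrite !inE => /andP[yx _]; exact: card_eq_coord.
  by rewrite sum_nat_const leq_mul2r subset_leq_card ?orbT // finset.subD1set.
(* A factor [d] is cancelled here, and only a nonempty [X] guarantees that it is positive. *)
have [X0|] := posnP #|X|; last by nia.
suff -> : Q = finset.set0 by rewrite cards0.
apply/setP => g; rewrite !inE; apply/negbTE/negP => /exists_inP [y].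
by rewrite (cards0_eq X0) inE.
Qed.

(* Exponential Markov: each colliding coordinate gets weight 16, so that the
   average weight of a coordinate is at most 2 while a crowded family weighs
   at least [4 ^ M]. *)
Lemma card_crowded_at d X x : #|X| <= d -> 16 * d <= #|C| ->
  2 ^ M * #|[set m | crowded_at m X x]| <= #|{ffun K -> C}| ^ M.
Proof.
move=> Xd dC; pose wt g := if collides X x g then 16 else 1.
have sum_wt : \sum_g wt g <= 2 * #|{ffun K -> C}|.
  have := card_collides x Xd dC; rewrite -sum1dep_card => h.
  have -> : \sum_g wt g = #|{ffun K -> C}| + 15 * \sum_(g | collides X x g) 1.
    rewrite -sum1_card big_distrr /= [X in _ + X]big_mkcond -big_split /=.
    by apply: eq_bigr => g _; rewrite /wt; case: ifP.
  lia.
have weight : \sum_(m : hash) \prod_i wt (m i) <= (2 * #|{ffun K -> C}|) ^ M.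
  rewrite -(bigA_distr_bigA (fun _ => wt)) prod_nat_const card_ord.
  by case: (posnP M) => M0; [rewrite M0|rewrite leq_exp2r].
have heavy : 4 ^ M * #|[set m | crowded_at m X x]| <=
    \sum_(m : hash) \prod_i wt (m i).
  rewrite mulnC -sum_nat_const [leqLHS]big_mkcond /=.
  apply: leq_sum => m _; case: ifP => // ; rewrite inE /crowded_at => crm.
  rewrite /wt -big_mkcond /= prod_nat_const -[16]/(4 ^ 2) -expnM.
  by rewrite leq_pexp2l // -cardsE.
have := leq_trans heavy weight.
by rewrite expnMn -[4]/(2 * 2) expnMn -mulnA leq_pmul2l // expn_gt0.
Qed.

(** Words of [d] colours stand in for neighbourhoods, which keeps the choice of [m] free of the
    graph. The extra factor [#|K|] pays for the union bound over [x]. *)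
Lemma exists_hash d : 0 < #|C| -> 16 * d <= #|C| ->
  exists m, 2 ^ M * #|[set s : {ffun 'I_d -> K} | crowded m (s @: [set: 'I_d])]|
    <= #|K| ^ d.+1.
Proof.
move=> C0 dC.
pose bad m :=
  [set p : {ffun 'I_d -> K} * K | crowded_at m (p.1 @: [set: 'I_d]) p.2].
have sum_bad : \sum_m 2 ^ M * #|bad m| <= #|K| ^ d.+1 * #|{: hash}|.
  have -> : \sum_m 2 ^ M * #|bad m| =
      \sum_(p : {ffun 'I_d -> K} * K)
        2 ^ M * #|[set m | crowded_at m (p.1 @: [set: 'I_d]) p.2]|.
    rewrite -!big_distrr /=; congr (_ * _).
    under eq_bigr do rewrite -sum1dep_card.
    under [RHS]eq_bigr do rewrite -sum1dep_card.
    by rewrite (exchange_big_dep xpredT).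
  apply: (@leq_trans (\sum_(p : {ffun 'I_d -> K} * K) #|{ffun K -> C}| ^ M)).
    apply: leq_sum => p _; apply: card_crowded_at dC.
    by rewrite (leq_trans (leq_imset_card _ _)) // cardsT card_ord.
  by rewrite sum_nat_const card_prod !card_ffun !card_ord expnS [_ * #|K|]mulnC.
have [m mP] : exists m, 2 ^ M * #|bad m| <= #|K| ^ d.+1.
  apply/existsP; apply: contraT; rewrite negb_exists => /forallP far.
  have : \sum_(m : hash) (#|K| ^ d.+1).+1 <= \sum_m 2 ^ M * #|bad m|.
    by apply: leq_sum => m _; rewrite ltnNge far.
  rewrite sum_nat_const mulnC => /leq_trans/(_ sum_bad).
  by rewrite leq_pmul2r ?ltnn // !card_ffun !expn_gt0 C0.
exists m; apply: leq_trans mP; rewrite leq_mul2l; apply/orP; right.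
have sub : [set s : {ffun 'I_d -> K} | crowded m (s @: [set: 'I_d])] \subset
    [set p.1 | p in bad m].
  apply/fintype.subsetP => s; rewrite inE => /existsP[x sx].
  by apply/imsetP; exists (s, x); rewrite ?inE.
exact: leq_trans (subset_leq_card sub) (leq_imset_card _ _).
Qed.

End Hashing.

(** Exchanging the colours on [N] with the first letters of a word is injective on pairs. Letters
    beyond [#|N|] only add colours, which a monotone [P] tolerates. *)
Lemma card_transfer (V K : finType) (N : {set V}) (d : nat) (P : pred {set K}) :
  (forall X Y : {set K}, X \subset Y -> P X -> P Y) -> (#|N| <= d)%N ->
  (#|[set f : {ffun V -> K} | P (f @: N)]| * #|K| ^ d
   <= #|[set s : {ffun 'I_d -> K} | P (s @: [set: 'I_d])]|
      * #|{ffun V -> K}|)%N.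
Proof.
move=> Pmono Nd.
pose e (i : 'I_d) := nth None [seq Some v | v <- enum N] i.
have e_onto v : v \in N -> exists i, e i = Some v.
  move=> vN; have iN : (index v (enum N) < #|N|)%N.
    by rewrite cardE index_mem mem_enum.
  exists (Ordinal (leq_trans iN Nd)).
  by rewrite /e (nth_map v) /= -?cardE // nth_index ?mem_enum.
have e_inj i j v : e i = Some v -> e j = Some v -> i = j.
  have sz k : e k = Some v -> (k < size (enum N))%N.
    rewrite /e; case: (ltnP k (size (enum N))) => // kN.
    by rewrite nth_default // size_map.
  move=> ei ej; apply/val_inj/eqP.
  have U : uniq [seq Some v | v <- enum N].
    by rewrite map_inj_uniq ?enum_uniq // => ? ? [].
  by rewrite -(nth_uniq None _ _ U) ?size_map ?sz // -/(e i) -/(e j) ei ej.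
pose swap (p : {ffun V -> K} * {ffun 'I_d -> K}) :=
  ([ffun i => if e i is Some v then p.1 v else p.2 i],
   [ffun v => if [pick i | e i == Some v] is Some i then p.2 i else p.1 v]).
have -> : (#|K| ^ d = #|[set: {ffun 'I_d -> K}]|)%N.
  by rewrite cardsT card_ffun card_ord.
rewrite -[X in (_ <= _ * X)%N]cardsT -!cardsX -(card_imset _ (f := swap)).
  apply/subset_leq_card/fintype.subsetP => _ /imsetP[[f s] + ->].
  rewrite !inE !andbT /=; apply: Pmono.
  apply/fintype.subsetP => _ /imsetP[v vN ->]; have [i ei] := e_onto v vN.
  by apply/imsetP; exists i; rewrite ?inE // ffunE ei.
move=> [f s] [g t] [/ffunP E1 /ffunP E2]; congr pair.
  apply/ffunP => v; have := E2 v; rewrite !ffunE; case: pickP => // i /eqP ei _.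
  by have := E1 i; rewrite !ffunE ei.
apply/ffunP => i; have := E1 i; rewrite !ffunE; case ei: (e i) => [v|] // _.
have := E2 v; rewrite !ffunE; case: pickP => [j /eqP ej|/(_ i)].
  by rewrite (e_inj _ _ _ ei ej).
by rewrite ei eqxx.
Qed.

(** * Split graphs with nested neighbourhoods *)

Section SplitGraph.
Variables (V : finType) (A : {set V}) (rk th : V -> nat).

Definition split_edge : rel V := fun u v => (u != v) &&
  (if u \in A then (v \notin A) && (rk u <= th v)%N
   else if v \in A then (rk v <= th u)%N else true).

Lemma split_sym : symmetric split_edge.
Proof.
move=> u v; rewrite /split_edge eq_sym.
by case: (u \in A); case: (v \in A).
Qed.

Lemma split_irr : irreflexive split_edge.
Proof. by move=> u; rewrite /split_edge eqxx. Qed.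

Definition split_graph : sgraph V := SGraph split_sym split_irr.

Lemma split_threshold (R : realType) : threshold_graph R split_graph.
Proof.
pose n := #|V|; pose L := (\max_v (maxn (rk v) (th v)))%N.
have rkL v : (rk v <= L)%N.
  by apply: leq_trans (leq_maxl _ _) (leq_bigmax (F := fun v => maxn _ _) v).
have thL v : (th v <= L)%N.
  by apply: leq_trans (leq_maxr _ _) (leq_bigmax (F := fun v => maxn _ _) v).
(* Vertices [w] outside [A] weigh [B (th w)], elements [a] of [A] weigh
   [b - n * B (rk a)]: [a] leaves room for all [w] with [rk a <= th w] together,
   but for no [w] with [th w < rk a]. *)
pose B k := (n.+1 ^ (L - k))%N.
have BL k : (B k <= B 0)%N by rewrite leq_pexp2l // subn0 leq_subr.
have Blt j k : (j < k)%N -> (k <= L)%N -> (n.+1 * B k <= B j)%N.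
  by move=> jk kL; rewrite -expnS leq_pexp2l //; lia.
have B0 k : (0 < B k)%N by rewrite expn_gt0.
(* With this value two elements of [A] weigh at least [2 * b - 2 * n * B 0 = b + 1], so they never
   fit together. *)
pose b := ((2 * n * B 0).+1)%N.
pose c v := (if v \in A then b - n * B (rk v) else B (th v))%N.
have nB v : (n * B (rk v) <= n * B 0)%N by rewrite leq_mul2l BL orbT.
exists (fun v => (c v)%:R), b%:R => x.
have -> : \sum_i (c i)%:R * (x i)%:R = (\sum_(i | x i) c i)%N%:R :> R.
  rewrite [RHS]natr_sum [RHS]big_mkcond /=; apply: eq_bigr => i _.
  by case: (x i); rewrite ?mulr1 ?mulr0.
rewrite ler_nat.
apply/idP/forall_inP => [le_b u xu|cl].
  apply/forall_inP => v xv; apply/implyP => uv.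
  rewrite !inE in xu xv; apply: contraLR le_b => nuv; rewrite -ltnNge.
  rewrite (bigD1 u) //= (bigD1 v) /= ?xv 1?eq_sym // addnA.
  apply: leq_trans (leq_addr _ _).
  move: nuv; rewrite /= /split_edge uv /= /c.
  have := nB u; have := nB v.
  case: ifP => uA; case: ifP => vA //=; rewrite -?ltnNge.
  - by rewrite /b; lia.
  - by move=> _ + /Blt /(_ (rkL u)); rewrite mulSn /b; have := B0 (rk u); lia.
  - by move=> + _ /Blt /(_ (rkL v)); rewrite mulSn /b; have := B0 (rk v); lia.
have {}cl u v : x u -> x v -> u != v -> split_edge u v.
  move=> xu xv; have /cl/forall_inP/(_ v) : u \in [set i | x i] by rewrite inE.
  by rewrite inE xv => /(_ isT)/implyP.
have sum_le (P : pred V) k : (forall v, P v -> (c v <= k)%N) ->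
    (\sum_(v | P v) c v <= n * k)%N.
  move=> ck; apply: leq_trans (leq_sum _ ck) _.
  by rewrite sum_nat_const leq_mul2r max_card orbT.
have [/existsP[a /andP[xa aA]]|noA] := boolP [exists a, x a && (a \in A)].
  rewrite (bigD1 a) //= {1}/c aA.
  suff : (\sum_(i | x i && (i != a)) c i <= n * B (rk a))%N.
    by have := nB a; rewrite /b; lia.
  apply: sum_le => v /andP[xv va]; have := cl a v xa xv.
  rewrite eq_sym va => /(_ isT) /andP[_]; rewrite aA /c => /andP[/negbTE -> h].
  by rewrite leq_pexp2l //; lia.
suff : (\sum_(i | x i) c i <= n * B 0)%N by rewrite /b; lia.
apply: sum_le => v xv; rewrite /c ifF //.
by apply: contraNF noA => vA; apply/existsP; exists v; rewrite xv.
Qed.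

End SplitGraph.

Lemma dimTH_le (R : realType) (V I : finType) (G : sgraph V)
    (H : I -> sgraph V) : (0 < #|I|)%N ->
  (forall i, threshold_graph R (H i)) ->
  (forall u v, G u v = [forall i, H i u v]) ->
  (dimTH R G <= #|I|)%N.
Proof.
move=> I0 Hth GH; rewrite /dimTH; case: ex_minnP => k _; apply.
apply/asboolP; split=> //; exists (fun i => H (enum_val i)).
split=> // u v; rewrite GH; apply/forallP/forallP => h i //.
by rewrite -(enum_rankK i).
Qed.

(** * Graphs of bounded degree *)

Section BoundedDegree.
Local Open Scope nat_scope.
Variables (V : finType) (G : sgraph V).
Local Notation d := (max_degree G).+1.

Definition closed_nbhd (w : V) : {set V} := [set v | (v == w) || G w v].
Local Notation N := closed_nbhd.

Lemma card_closed_nbhd w : #|N w| <= d.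
Proof.
have -> : N w = w |: [set v | G w v] by apply/setP => v; rewrite !inE.
rewrite cardsU1; have := leq_bigmax (F := degree G) w.
rewrite -/(max_degree G) /degree; lia.
Qed.

Lemma closed_nbhd_sym u v : (u \in N v) = (v \in N u).
Proof. by rewrite !inE eq_sym edge_sym. Qed.

Lemma card_meeting_nbhds w : #|[set v | ~~ [disjoint N w & N v]]| <= d ^ 2.
Proof.
have sub : [set v | ~~ [disjoint N w & N v]] \subset \bigcup_(u in N w) N u.
  apply/fintype.subsetP => v; rewrite inE => /pred0Pn[u /andP[uw uv]].
  by apply/bigcupP; exists u; rewrite // closed_nbhd_sym.
apply: leq_trans (subset_leq_card sub) _.
apply: leq_trans (card_big_setU _ _ _) _.
apply: leq_trans (leq_sum _ (fun u _ => card_closed_nbhd u)) _.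
by rewrite sum_nat_const expnS expn1 leq_mul2r card_closed_nbhd orbT.
Qed.

(** A neighbourhood repeats a colour with probability at most [d^2 / (8 d^4)] and is crowded with
    probability at most [8 d^4 / 2^M]. Each is at most [1 / (8 d^2)], so the local lemma applies
    with [D = d^2]. *)
Lemma exists_coloring (C : finType) (M : nat) :
  16 * d <= #|C| -> 64 * d ^ 6 <= 2 ^ M ->
  exists (m : {ffun 'I_M -> {ffun 'I_(8 * d ^ 4) -> C}})
         (f : {ffun V -> 'I_(8 * d ^ 4)}),
    forall w, {in N w &, injective f} /\ ~~ crowded m (f @: N w).
Proof.
move=> dC dM; set K := 'I_(8 * d ^ 4).
have C0 : 0 < #|C| by apply: leq_trans dC; rewrite muln_gt0.
have [m mP] := @exists_hash K C M d C0 dC.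
pose collapsed w (f : {ffun V -> K}) :=
  [exists u in N w, exists v in N w, (u != v) && (f u == f v)].
pose bad w := [set f : {ffun V -> K} | collapsed w f] :|:
    [set f : {ffun V -> K} | crowded m (f @: N w)].
have [||w|w|w|f fP] := @local_lemma V K V N bad (d ^ 2).
- by rewrite card_ord muln_gt0 expn_gt0.
- by rewrite expn_gt0.
- move=> f g fg; rewrite !inE (eq_in_imset fg); congr orb.
  apply: eq_existsb => u; case: (boolP (u \in N w)) => //= uN.
  apply: eq_existsb => v; case: (boolP (v \in N w)) => //= vN.
  by rewrite !fg.
- exact: card_meeting_nbhds.
- have Kd : #|K| = 8 * d ^ 4 by rewrite card_ord.
  have le1 : 8 * d ^ 2 * #|[set f | collapsed w f]| <= #|{ffun V -> K}|.
    have cover : [set f | collapsed w f] \subset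
        \bigcup_(p in finset.setX (N w) (N w) | p.1 != p.2)
          [set f : {ffun V -> K} | f p.1 == f p.2].
      apply/fintype.subsetP => f; rewrite inE.
      case/exists_inP => u uN /exists_inP[v vN /andP[uv fuv]].
      by apply/bigcupP; exists (u, v); rewrite ?finset.in_setX ?uN ?vN ?uv ?inE.
    have : #|[set f | collapsed w f]| * #|K| <= d ^ 2 * #|{ffun V -> K}|.
      apply: leq_trans (leq_mul (subset_leq_card cover) (leqnn _)) _.
      apply: leq_trans (leq_mul (card_big_setU _ _ _) (leqnn _)) _.
      rewrite big_distrl /=.
      apply: (@leq_trans
        (\sum_(p in finset.setX (N w) (N w)) #|{ffun V -> K}|)).
        rewrite big_mkcondr; apply: leq_sum => p _.
        by case: ifP => // /card_eq_coord.
      rewrite sum_nat_const leq_mul2r cardsX; apply/orP; right.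
      by rewrite -mulnn leq_mul ?card_closed_nbhd.
    rewrite Kd; set x := #|_|; set y := #|_| => h.
    rewrite -(leq_pmul2l (_ : 0 < d ^ 2)) ?expn_gt0 //.
    by apply: leq_trans h; rewrite [d ^ 4](expnD d 2 2); lia.
  have le2 : 8 * d ^ 2 * #|[set f : {ffun V -> K} | crowded m (f @: N w)]|
      <= #|{ffun V -> K}|.
    set x := #|_|; set y := #|_|.
    pose z := #|[set s : {ffun 'I_d -> K} | crowded m (s @: [set: 'I_d])]|.
    have xy : x * #|K| ^ d <= z * y.
      exact: card_transfer (@crowded_sub _ _ _ m) (card_closed_nbhd w).
    have Kd0 : 0 < #|K| ^ d by rewrite Kd expn_gt0 muln_gt0 expn_gt0.
    have : 2 ^ M * x <= #|K| * y.
      rewrite -(leq_pmul2r Kd0) -mulnA.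
      apply: leq_trans (leq_mul (leqnn _) xy) _.
      by rewrite mulnA [_ * y * _]mulnAC -expnS leq_mul2r mP orbT.
    move=> h; have := leq_trans (leq_mul dM (leqnn x)) h; rewrite Kd => {}h.
    rewrite -(leq_pmul2l (_ : 0 < 8 * d ^ 4)) ?muln_gt0 ?expn_gt0 //.
    by apply: leq_trans h; rewrite [d ^ 6](expnD d 4 2); lia.
  have le3 := (leq_card_setU [set f | collapsed w f]
    [set f : {ffun V -> K} | crowded m (f @: N w)]).1.
  have := leq_mul (leqnn (8 * d ^ 2)) le3; rewrite mulnDr => le4.
  have le5 := leq_trans le4 (leq_add le1 le2).
  rewrite -(leq_pmul2l (isT : 0 < 2)) mulnA (mulnA 2 4).
  by rewrite [2 * #|_|]mul2n -addnn.
exists m, f => w; have := fP w; rewrite !inE negb_or => /andP[inj cr].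
split=> //.
move=> u v uN vN fuv; apply/eqP; apply: contraNT inj => uv.
apply/exists_inP; exists u => //.
by apply/exists_inP; exists v; rewrite ?uv ?fuv ?eqxx.
Qed.

Lemma dimTH_bound (R : realType) (M : nat) : 64 * d ^ 6 <= 2 ^ M ->
  dimTH R G <= M * (16 * d) * 2.
Proof.
move=> dM; pose C := 'I_(16 * d).
have [m [f fP]] := @exists_coloring C M (eq_leq (esym (card_ord _))) dM.
pose cl (i : 'I_M) (v : V) : C := m i (f v).
pose A (i : 'I_M) (j : C) :=
  [set v | (cl i v == j) && [forall u, G v u ==> (cl i u != j)]].
(* Two opposite orders of [V]. Ranks are positive, so that the empty maximum 0 in [th] lies below
   all of them. *)
pose rk (b : bool) (v : V) : nat :=
  if b then (enum_rank v).+1 else #|V| - enum_rank v.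
pose th i j b w : nat := \max_(a in A i j | G w a) rk b a.
pose H (p : 'I_M * C * bool) :=
  split_graph (A p.1.1 p.1.2) (rk p.2) (th p.1.1 p.1.2 p.2).
have rk_gt0 b v : 0 < rk b v.
  by rewrite /rk; case: b => //; rewrite subn_gt0.
have -> : M * (16 * d) * 2 = #|{: 'I_M * C * bool}|.
  by rewrite !card_prod !card_ord card_bool.
have M0 : 0 < M by case: M dM {m fP cl A th H} => //; nia.
have indep i j a v : a \in A i j -> G a v -> v \notin A i j.
  rewrite inE => /andP[_ /forallP/(_ v)] + Gav; rewrite Gav /= inE.
  by move=> /negbTE ->.
have le_th i j b a v : a \in A i j -> G v a -> rk b a <= th i j b v.
  by move=> aA Gva; apply: (leq_bigmax_cond (F := rk b)); rewrite aA.
apply: (dimTH_le (H := H)) => [|p|u w].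
- by rewrite !card_prod !card_ord card_bool !muln_gt0 M0.
- exact: split_threshold.
apply/idP/forallP => [Guw [[i j] b]|Hall].
  have uw : u != w by apply: contraTneq Guw => ->; rewrite edge_irr.
  rewrite /= /split_edge uw /=.
  case: ifP => [uA|_]; last by case: ifP => // wA; apply: le_th.
  by rewrite (indep _ _ _ _ uA Guw) le_th // edge_sym.
apply: contraT => nGuw.
have uw : u != w.
  have := Hall (Ordinal M0, Ordinal (isT : 0 < 16 * d), true).
  by rewrite /= /split_edge => /andP[].
have sparse v : 2 * #|[set i | collides (f @: N v) (f u) (m i)]| < M.
  rewrite ltnNge; have [_] := fP v.
  by rewrite negb_exists => /forallP/(_ (f u)).
(* Each of the two neighbourhoods spoils fewer than half of the [M] functions. *)
have [i iw iu] : exists2 i, ~~ collides (f @: N w) (f u) (m i) &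
                           ~~ collides (f @: N u) (f u) (m i).
  pose B v := [set i | collides (f @: N v) (f u) (m i)].
  have : 0 < #|~: (B w :|: B u)|.
    have := cardsC (B w :|: B u); rewrite card_ord.
    have := (leq_card_setU (B w) (B u)).1; have := sparse w; have := sparse u.
    rewrite -/(B w) -/(B u); lia.
  by case/card_gt0P => i; rewrite !inE negb_or => /andP[iw iu]; exists i.
have alike v a : a \in N v -> ~~ collides (f @: N v) (f u) (m i) ->
    cl i a = cl i u -> f a = f u.
  move=> av nc ca; apply/eqP; apply: contraNT nc => fau.
  apply/exists_inP; exists (f a); first exact: imset_f.
  by rewrite fau -/(cl i a) ca /=.
set j := cl i u.
have uA : u \in A i j.
  rewrite inE eqxx; apply/forallP => v; apply/implyP => Guv.
  have uN : u \in N u by rewrite inE eqxx.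
  have vN : v \in N u by rewrite inE Guv orbT.
  apply: contraTneq Guv => /(alike u v vN iu) /(fP u).1 -> //.
  by rewrite edge_irr.
have same a : a \in A i j -> G w a -> a \in N w /\ f a = f u.
  rewrite inE => /andP[/eqP ca _] Gwa.
  have aN : a \in N w by rewrite inE Gwa orbT.
  by split=> //; exact: (alike w).
suff [b] : exists b, th i j b w < rk b u.
  have := Hall (i, j, b); rewrite /= /split_edge uw uA /= => /andP[_].
  by rewrite leqNgt => /negbTE ->.
have [a /andP[aA Gwa]|none] := pickP (fun a => (a \in A i j) && G w a);
  last first.
  by exists true; rewrite /th big_pred0.
have th_le b : th i j b w <= rk b a.
  apply/bigmax_leqP => a' /andP[a'A Gwa'].
  have [aN fa] := same a aA Gwa; have [a'N fa'] := same a' a'A Gwa'.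
  by rewrite ((fP w).1 a' a) // fa.
have au : (enum_rank a : nat) != enum_rank u.
  rewrite (inj_eq val_inj) (inj_eq enum_rank_inj).
  by apply: contraNneq nGuw => <-; rewrite edge_sym.
(* The order is chosen so that [a], the only neighbour of [w] in [A i j], comes before [u]. *)
exists (enum_rank a < enum_rank u); apply: leq_ltn_trans (th_le _) _.
have lt_rank (v : V) : enum_rank v < #|V| by exact: ltn_ord.
move: (lt_rank a) (lt_rank u) au; rewrite /rk.
case: (ltnP (enum_rank a) (enum_rank u)); lia.
Qed.
End BoundedDegree.

(** * Numerical estimates *)

Section Numeric.
Variable R : realType.

Lemma ln_ge (x y : R) : expR x <= y -> x <= ln y.
Proof.
move=> xy; have y0 := lt_le_trans (expR_gt0 x) xy.
by rewrite -ler_expR lnK // posrE.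
Qed.

Lemma onemV_le_ln (x : R) : 0 < x -> 1 - x^-1 <= ln x.
Proof.
move=> x0; have := @le_ln1Dx R (x^-1 - 1).
rewrite addrCA subrr addr0 lnV ?posrE //.
have x1 : 0 < x^-1 by rewrite invr_gt0.
by move=> /(_ ltac:(lra)); lra.
Qed.

(** A margin above 1 keeps [ln (ln Delta)] away from 0 down to [Delta = 3]. *)
Lemma ln3_ge : 105 / 100 <= ln (3 : R).
Proof.
have e21 : (95 / 100) ^+ 21 <= expR (- (105 / 100) : R).
  have -> : - (105 / 100) = 21%:R * - (5 / 100) :> R by field.
  rewrite expRM_natl lerXn2r ?nnegrE ?expR_ge0 //.
  by apply: le_trans (expR_ge1Dx _); lra.
apply: ln_ge.
rewrite -[leLHS]invrK -expRN -[3]invrK lef_pV2 ?posrE ?expR_gt0 //.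
by apply: le_trans e21; rewrite !exprS expr0; lra.
Qed.

Lemma log2_le_ln (n : nat) : (0 < n)%N ->
  (trunc_log 2 n)%:R <= 2 * ln (n%:R : R).
Proof.
move=> n0; have /(trunc_logP (isT : (1 < 2)%N)) := n0.
rewrite -(ler_nat R) natrX -ler_ln ?posrE ?exprn_gt0 ?ltr0n //.
rewrite lnXn // -[leLHS]mulr_natr; have := @onemV_le_ln 2 (ltr0n _ 2).
set t := (trunc_log _ _)%:R => h.
have t0 : 0 <= t by rewrite ler0n.
have h2 : 1 / 2 <= ln 2 :> R by lra.
by have := ler_wpM2r t0 h2; lra.
Qed.

Lemma numeric_bound (n : nat) : (3 <= n)%N ->
  ((12 + 6 * trunc_log 2 n) * (16 * n.+1) * 2)%N%:R <=
  243 * 100 * n%:R * ln (n%:R) ^+ 2 * ln (ln (n%:R))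
   * (2 * expR 1) `^ Num.sqrt (ln (ln (n%:R))) :> R.
Proof.
move=> n3; set L := ln n%:R.
have n3R : 3 <= n%:R :> R by rewrite ler_nat.
(* This gives [ln L >= 1 - 1 / 1.05 = 1 / 21] below. *)
have L105 : 105 / 100 <= L.
  by apply: le_trans ln3_ge _; rewrite ler_ln ?posrE //; lra.
have LL : 1 / 21 <= ln L.
  apply: (@le_trans _ _ (1 - L^-1)); last by apply: onemV_le_ln; lra.
  have : L^-1 <= (105 / 100)^-1 by rewrite lef_pV2 ?posrE //; lra.
  by lra.
have pow1 : 1 <= (2 * expR 1) `^ Num.sqrt (ln L).
  rewrite -[leLHS](powRr0 (2 * expR 1)) ler_powR ?sqrtr_ge0 //.
  by have := @expR_ge1Dx R 1; lra.
have t2 : (trunc_log 2 n)%:R <= 2 * L by apply: log2_le_ln; lia.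
rewrite !natrM natrD natrM -[n.+1]addn1 natrD.
apply: (@le_trans _ _ (243 * 100 * n%:R * L ^+ 2 * ln L)); last first.
  by rewrite ler_peMr // !mulr_ge0 ?sqr_ge0 //; lra.
(* Since [n + 1 <= 4 n / 3], the constant is [12 * 32 * 4 / 3 = 512]. *)
apply: (@le_trans _ _ (512 * n%:R * (1 + L))).
  set t := (trunc_log _ _)%:R in t2 *; nra.
apply: (@le_trans _ _ (243 * 100 * n%:R * L ^+ 2 * (1 / 21))); last first.
  by rewrite ler_wpM2l // !mulr_ge0 ?sqr_ge0 //; lra.
have : 512 * (1 + L) <= 243 * 100 * L ^+ 2 * (1 / 21) by nra.
nra.
Qed.
End Numeric.

Local Open Scope classical_set_scope.

Theorem theorem5 (R : realType) :
  exists eps1 eps2 : nat -> R,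
    eps1 n @[n --> \oo] --> (0 : R) /\
    eps2 n @[n --> \oo] --> (0 : R) /\
    forall (V : finType) (G : sgraph V) (Delta : nat),
      max_degree G = Delta -> (3 <= Delta)%N ->
      (dimTH R G)%:R <=
        (243 * 100 + eps1 Delta) * Delta%:R * ln (Delta%:R) ^+ 2
          * ln (ln (Delta%:R))
          * (2 * expR 1) `^ Num.sqrt ((1 + eps2 Delta) * ln (ln (Delta%:R))).
Proof.
exists (fun=> 0), (fun=> 0); split; first exact: cvg_cst.
split; first exact: cvg_cst.
move=> V G Delta GD D3; rewrite addr0 addr0 mul1r.
apply: le_trans (numeric_bound R D3); rewrite ler_nat -GD.
apply: dimTH_bound; rewrite GD.
(* The first 6 gives [2^6 = 64]; the rest gives the sixth power of a power of 2 exceeding [Delta],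
   hence at least [d]. *)
have -> : (12 + 6 * trunc_log 2 Delta = 6 + (trunc_log 2 Delta).+1 * 6)%N.
  by lia.
by rewrite expnD expnM leq_mul // leq_exp2r // trunc_log_ltn.
Qed.
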